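(* Let $G$ be a complete graph with $\Delta(G)\ge 3$ and let $m,n$ be integers with $1<m<n$. Then $\chi(G^{\frac{m}{n}})=\omega(G^{\frac{m}{n}})$.
   Context: For a graph $G$ and positive integer $n$, the $n$-subdivision $G^{\frac{1}{n}}$ is obtained from $G$ by replacing each edge with a path of length $n$. For a graph $H$ and positive integer $m$, the $m$-th power $H^m$ is the graph on $V(H)$ in which two distinct vertices are adjacent iff their distance in $H$ is at most $m$. The fractional power is $G^{\frac{m}{n}}=(G^{\frac{1}{n}})^m$. $\chi$ denotes the chromatic number and $\omega$ the clique number. *)

(* Defs.v *)
From mathcomp Require Import all_boot.

Set Implicit Arguments.
Unset Strict Implicit.
Unset Printing Implicit Defensive.

Record sgraph := SGraph {
  vertex :> finType;
  adj : rel vertex;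
  adj_sym : symmetric adj;
  adj_irrefl : irreflexive adj }.

Definition complete (G : sgraph) : Prop :=
  forall x y : G, x != y -> adj x y.

Definition degree (G : sgraph) (x : G) : nat := #|[set y : G | adj x y]|.

Definition max_degree (G : sgraph) : nat := \max_(x : G) degree x.

Definition clique (G : sgraph) (A : {set G}) : bool :=
  [forall x in A, forall y in A, (x != y) ==> adj x y].

Definition clique_number (G : sgraph) : nat :=
  \max_(A : {set G} | clique A) #|A|.

Definition proper (G : sgraph) (k : nat) (f : {ffun G -> 'I_k}) : bool :=
  [forall x, forall y, adj x y ==> (f x != f y)].

Definition colorable (G : sgraph) (k : nat) : bool :=
  [exists f : {ffun G -> 'I_k}, proper f].

Lemma colorable_ex (G : sgraph) : exists k, colorable G k.
Proof.
exists #|G|; apply/existsP; exists [ffun x => enum_rank x].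
apply/forallP => x; apply/forallP => y; apply/implyP => xy.
rewrite !ffunE; apply: contraTneq xy => /enum_rank_inj ->.
by rewrite adj_irrefl.
Qed.

Definition chromatic_number (G : sgraph) : nat := ex_minn (colorable_ex G).

Definition walk (G : sgraph) (k : nat) (x y : G) : bool :=
  [exists p : k.-tuple G, path (@adj G) x p && (last x p == y)].

(* The length of a shortest walk from x to y, None standing for infinity.
   A shortest walk visits no vertex twice, so has length less than #|G|. *)
Definition dist (G : sgraph) (x y : G) : option nat :=
  let k := find (fun k => walk k x y) (iota 0 #|G|) in
  if k < #|G| then Some k else None.

Definition dist_le (G : sgraph) (m : nat) (x y : G) : bool :=
  if dist x y is Some k then k <= m else false.

Lemma walkP (G : sgraph) (k : nat) (x y : G) :
  reflect (exists p, [/\ path (@adj G) x p, last x p = y & size p = k])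
          (walk k x y).
Proof.
apply: (iffP existsP) => [[p /andP[xp /eqP yp]] | [p [xp yp /eqP kp]]].
  by exists p; rewrite size_tuple.
by exists (Tuple kp); rewrite /= xp yp eqxx.
Qed.

Lemma walk_sym (G : sgraph) (k : nat) : symmetric (@walk G k).
Proof.
suff W (x y : G) : walk k x y -> walk k y x by move=> x y; apply/idP/idP; apply: W.
case/walkP=> p [xp <- <-]; apply/walkP; exists (rev (belast x p)); split.
- by rewrite rev_path (eq_path (e' := @adj G)) // => u v; rewrite adj_sym.
- by case: p xp => //= z p _; rewrite rev_cons last_rcons.
- by rewrite size_rev size_belast.
Qed.

Lemma dist_leP (G : sgraph) (m : nat) (x y : G) :
  reflect (exists2 k, k <= m & walk k x y) (dist_le m x y).
Proof.
rewrite /dist_le /dist; set k := find _ _.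
have nthE i : i < #|G| -> nth 0 (iota 0 #|G|) i = i by move=> iG; rewrite nth_iota.
apply: (iffP idP) => [|[j jm /walkP[p [xp yp sp]]]].
  case: ifP => // kG km; exists k => //.
  suff: walk (nth 0 (iota 0 #|G|) k) x y by rewrite nthE.
  by apply: (nth_find 0 (a := fun i => walk i x y)); rewrite has_find size_iota.
have [q [xq yq uq sq]] : exists q,
    [/\ path (@adj G) x q, last x q = y, uniq (x :: q) & size q <= size p].
  case: (shortenP xp) yp => q xq uq sq yq; exists q; split=> //.
  by apply: uniq_leq_size => //; case/andP: uq.
have qG : size q < #|G|.
  by rewrite -[_.+1]/(size (x :: q)) -(card_uniqP uq) max_card.
have kq : k <= size q.
  rewrite leqNgt; apply/negP => /(before_find 0).
  by rewrite nthE // => /walkP; apply; exists q.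
by rewrite (leq_ltn_trans kq qG) (leq_trans kq) // (leq_trans sq) // sp.
Qed.

Definition pow_adj (G : sgraph) (m : nat) : rel G :=
  fun x y => (x != y) && dist_le m x y.

Lemma pow_adj_sym (G : sgraph) (m : nat) : symmetric (@pow_adj G m).
Proof.
move=> x y; rewrite /pow_adj eq_sym; congr (_ && _).
by apply/dist_leP/dist_leP=> -[k km]; rewrite walk_sym => w; exists k.
Qed.

Lemma pow_adj_irrefl (G : sgraph) (m : nat) : irreflexive (@pow_adj G m).
Proof. by move=> x; rewrite /pow_adj eqxx. Qed.

Definition power (G : sgraph) (m : nat) : sgraph :=
  SGraph (@pow_adj_sym G m) (@pow_adj_irrefl G m).

(* Each edge is listed once, as the pair of its ends in the order of
   enum_rank; this orients the path that replaces it. *)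
Definition is_edge (G : sgraph) (p : G * G) : bool :=
  adj p.1 p.2 && (enum_rank p.1 < enum_rank p.2).

Definition edge (G : sgraph) : finType := {p : G * G | is_edge p}.

Definition subdiv_vertex (G : sgraph) (n : nat) : finType :=
  (G + edge G * 'I_n.-1)%type.

(* The vertex at distance k <= n from the first end on the path of length n
   that replaces p: positions 0 and n are the ends of p, and position k with
   0 < k < n is the new vertex of index k.-1. *)
Definition edge_point (G : sgraph) (n : nat) (p : edge G) (k : nat) :
    subdiv_vertex G n :=
  if k is k'.+1 then
    if insub k' is Some i then inr (p, i) else inl (val p).2
  else inl (val p).1.

Definition subdiv_adj (G : sgraph) (n : nat) : rel (subdiv_vertex G n) :=
  fun x y => [exists p : edge G, exists k : 'I_n,
    ((x == edge_point n p k) && (y == edge_point n p k.+1)) ||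
    ((y == edge_point n p k) && (x == edge_point n p k.+1))].

Lemma subdiv_adj_sym (G : sgraph) (n : nat) : symmetric (@subdiv_adj G n).
Proof.
by move=> x y; apply: eq_existsb => p; apply: eq_existsb => k; rewrite orbC.
Qed.

Lemma edge_point_neq (G : sgraph) (n : nat) (p : edge G) (k : nat) :
  k < n -> edge_point n p k != edge_point n p k.+1.
Proof.
case: k => [|k] kn /=; case: insubP => [i _ iE|] //.
  have /andP[p12 _] := valP p; rewrite -leqNgt => _.
  by apply/eqP => -[E]; move: p12; rewrite E adj_irrefl.
  case: insubP => [j _ jE|] //; apply/eqP => -[E].
  by move: iE; rewrite E jE => /eqP; rewrite eqn_leq ltnn.
by case/negP; case: n kn.
Qed.

Lemma subdiv_adj_irrefl (G : sgraph) (n : nat) : irreflexive (@subdiv_adj G n).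
Proof.
move=> x; apply/negbTE/existsPn => p; apply/existsPn => k.
have := edge_point_neq p (ltn_ord k); apply: contraNN.
by case/orP=> /andP[/eqP <- /eqP <-].
Qed.

Definition subdivision (G : sgraph) (n : nat) : sgraph :=
  SGraph (@subdiv_adj_sym G n) (@subdiv_adj_irrefl G n).

Definition frac_power (G : sgraph) (m n : nat) : sgraph :=
  power (subdivision G n) m.

(* Main.v *)
Require Import Defs.
From mathcomp Require Import all_boot zify.

(* Write N = 1 + (m mod 2) + (k - 1) floor(m/2) for K_k.  A ball of radius
   floor(m/2) around a vertex, with one more point when m is odd, is a clique of
   size N, so it suffices to colour with N colours.  A colouring is a family of
   colour words, one per edge; since m < n, points on different edges interact only
   through a common end.  Repeating a period of m + 1 letters in each word reduces
   to n <= 2m + 1.  Starting from small cases, one raises m by inserting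
   letters near both ends of each word, taken from k - 1 new colours per unit of
   radius, and by inserting in the middle of the word the new colours of other edges
   at its ends.  For k >= 5 each edge has two such other colours, which reaches
   every n.  For K_4 there is only one, so two units of radius are added at once
   when the words are short, and when they are long the two ends share the colours
   of a perfect matching. *)

Set Implicit Arguments.
Unset Strict Implicit.
Unset Printing Implicit Defensive.

(** * Families of colour words and general ways of lengthening them *)

(* [c u v p] is the colour of the point at distance [p] from [u] on the path
   replacing the edge [uv] of K_k, whose vertices are numbered from 0.  The range
   [e] of the constraints along one path is separate from the range [m] of those
   across a common end: [e = m] is what the theorem needs, while [e = n.-1] says
   that the colours on a path are distinct, except possibly at its two ends. *)
Record scheme (k e m n N : nat) (c : nat -> nat -> nat -> nat) : Prop := Scheme {
  scheme_lt : forall u v p, u < k -> v < k -> u != v -> p <= n -> c u v p < N;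
  scheme_sym : forall u v p, u < k -> v < k -> u != v -> p <= n ->
    c v u p = c u v (n - p);
  scheme_center : forall u v w, u < k -> v < k -> w < k -> u != v -> u != w ->
    c u v 0 = c u w 0;
  scheme_edge : forall u v p q, u < k -> v < k -> u != v ->
    p < q -> q <= n -> q <= p + e -> c u v p <> c u v q;
  scheme_star : forall u v w p q, u < k -> v < k -> w < k ->
    u != v -> u != w -> v != w -> 0 < p -> 0 < q -> p <= n -> q <= n ->
    p + q <= m -> c u v p <> c u w q }.

(* A path coloured c_0 ... c_n is replaced by c_0 ... c_m c_0 ... c_n, read from
   the end with the smaller number. *)
Lemma scheme_periodic k m n N c : m < n ->
  scheme k m m n N c -> exists c', scheme k m m (n + m.+1) N c'.
Proof.
move=> mn [clt csym cc cedge cstar].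
exists (fun u v p =>
  if p <= (if u < v then m else n) then c u v p else c u v (p - m.+1)).
split.
- by move=> u v p uk vk uv pn; case: (u < v); case: ifP => pm; apply: clt => //; lia.
- move=> u v p uk vk uv pn; have -> : (v < u) = ~~ (u < v) by lia.
  case: (u < v) => /=; case: ifP => pm; case: ifP => qm; try lia.
  + by rewrite csym //; first (congr c; lia); lia.
  + by rewrite csym //; first (congr c; lia); lia.
  + by rewrite csym //; first (congr c; lia); lia.
  + by rewrite csym //; first (congr c; lia); lia.
- by move=> u v w uk vk wk uv uw /=; apply: cc.
- move=> u v p q uk vk uv pq qn qm.
  have [t [-> mt tn]] : exists t, [/\ (if u < v then m else n) = t, m <= t & t <= n].
    by case: (u < v); [exists m | exists n]; split=> //; lia.
  case: ifP => pm; case: ifP => qm'; try lia.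
  + by apply: cedge => //; lia.
  (* Here [p] is in the first copy and [q] in the second: the letter at [q] is that of [q - m.+1],
     which precedes [p] by at most [m]. *)
  + by apply/nesym; apply: cedge => //; lia.
  + by apply: cedge => //; lia.
- move=> u v w p q uk vk wk uv uw vw p0 q0 pn qn pq.
  (* Both [p] and [q] are below [m], and the repetition keeps the letters at distance at most [m]
     from either end. *)
  have -> : p <= (if u < v then m else n) by case: (u < v); lia.
  have -> : q <= (if u < w then m else n) by case: (u < w); lia.
  by apply: cstar => //; lia.
Qed.

(* [isnew] marks the inserted positions and [old] renumbers the others; the
   inserted points receive the fresh colours [N + g u v p]. *)
Lemma scheme_insert k e m n N c e' m' n' K (isnew : pred nat) (old : nat -> nat)
    (g : nat -> nat -> nat -> nat) :
  scheme k e m n N c ->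
  isnew 0 = false -> old 0 = 0 ->
  (forall p, p <= n' -> isnew (n' - p) = isnew p) ->
  (forall p, p <= n' -> ~~ isnew p -> old p <= n /\ old (n' - p) = n - old p) ->
  (forall p q, p < q -> q <= n' -> q <= p + e' -> ~~ isnew p -> ~~ isnew q ->
    old p < old q /\ old q <= old p + e) ->
  (forall p q, 0 < p -> 0 < q -> p <= n' -> q <= n' -> p + q <= m' ->
    ~~ isnew p -> ~~ isnew q ->
    0 < old p /\ 0 < old q /\ old p + old q <= m) ->
  (forall u v p, u < k -> v < k -> u != v -> p <= n' -> isnew p ->
    g u v p < K /\ g v u p = g u v (n' - p)) ->
  (forall u v p q, u < k -> v < k -> u != v -> p < q -> q <= n' -> q <= p + e' ->
    isnew p -> isnew q -> g u v p <> g u v q) ->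
  (forall u v w p q, u < k -> v < k -> w < k -> u != v -> u != w -> v != w ->
    p <= n' -> q <= n' -> p + q <= m' -> isnew p -> isnew q ->
    g u v p <> g u w q) ->
  scheme k e' m' n' (N + K)
    (fun u v p => if isnew p then N + g u v p else c u v (old p)).
Proof.
move=> [clt csym cc cedge cstar] new0 old0 newS oldS oldE oldT gS gE gT.
split.
- move=> u v p uk vk uv pn; case: ifPn => np.
    by have [] := gS u v p uk vk uv pn np; lia.
  by have [pn' _] := oldS p pn np; have := clt u v _ uk vk uv pn'; lia.
- move=> u v p uk vk uv pn; rewrite newS //; case: ifPn => np.
    by have [_ ->] := gS u v p uk vk uv pn np.
  by have [pn' ->] := oldS p pn np; rewrite csym.
- by move=> u v w uk vk wk uv uw; rewrite new0 old0; apply: cc.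
- move=> u v p q uk vk uv pq qn qe.
  have pn : p <= n' by lia.
  case: ifPn => np; case: ifPn => nq.
  + by have := gE u v p q uk vk uv pq qn qe np nq; lia.
  + by have [qn' _] := oldS q qn nq; have := clt u v _ uk vk uv qn'; lia.
  + by have [pn' _] := oldS p pn np; have := clt u v _ uk vk uv pn'; lia.
  + have [opq oqe] := oldE p q pq qn qe np nq.
    by apply: cedge => //; case: (oldS q qn nq).
- move=> u v w p q uk vk wk uv uw vw p0 q0 pn qn pqm.
  case: ifPn => np; case: ifPn => nq.
  + by have := gT u v w p q uk vk wk uv uw vw pn qn pqm np nq; lia.
  + by have [qn' _] := oldS q qn nq; have := clt u w _ uk wk uw qn'; lia.
  + by have [pn' _] := oldS p pn np; have := clt u v _ uk vk uv pn'; lia.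
  + have [op [oq opq]] := oldT p q p0 q0 pn qn pqm np nq.
    by apply: cstar => //; [case: (oldS p pn np) | case: (oldS q qn nq)].
Qed.

(** * Insertions coloured by classes of half-edges *)

(* The class of the half-edge at [u] of the edge [uv]: the rank of [v] among the
   vertices other than [u], rotated by the parity of [u] so that the two halves of
   an edge get different classes. *)
Definition cls (k u v : nat) := (v - (u < v) + odd u) %% k.-1.

Lemma cls_lt k u v : 1 < k -> cls k u v < k.-1.
Proof. by move=> k1; rewrite ltn_mod; lia. Qed.

Lemma clsE k u v : 2 < k -> u < k -> v < k -> u != v ->
  cls k u v = (let x := v - (u < v) + odd u in if x < k.-1 then x else x - k.-1).
Proof.
move=> k2 uk vk uv; rewrite /cls /=; set x := _ + _.
have xlt : x < k.-1.*2 by rewrite /x; lia.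
case: ifP => xk; first by rewrite modn_small.
by rewrite -{1}(subnK (m := k.-1) (n := x)) ?modnDr ?modn_small; lia.
Qed.

Lemma cls_neq_sym k u v : 2 < k -> u < k -> v < k -> u != v ->
  cls k u v <> cls k v u.
Proof.
move=> k2 uk vk uv; rewrite !clsE //= 1?eq_sym //.
by do 2 case: ifP; lia.
Qed.

Lemma cls_inj k u v w : 2 < k -> u < k -> v < k -> w < k ->
  u != v -> u != w -> v != w -> cls k u v <> cls k u w.
Proof.
by move=> k2 uk vk wk uv uw vw; rewrite !clsE //=; do 2 case: ifP; lia.
Qed.

(** The new points sit next to the two ends and carry the classes of their half-edges, which differ
    along an edge by [cls_neq_sym] and around a vertex by [cls_inj]. Letters stay distinct except
    possibly at the two ends, so the step can be iterated with [n - m] fixed. *)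
Lemma scheme_extend_low k m n N c : 2 < k -> m < n ->
  scheme k n.-1 m n N c ->
  exists c', scheme k n.+1 m.+2 n.+2 (N + k.-1) c'.
Proof.
move=> k2 mn S; eexists.
apply: (scheme_insert (isnew := fun p => (p == 1) || (p == n.+1))
  (old := fun p => p - (1 < p) - (n.+1 < p))
  (g := fun u v p => if p == 1 then cls k u v else cls k v u) S) => //.
- by move=> p; lia.
- by move=> p; lia.
- by move=> p q; lia.
- by move=> p q; lia.
- move=> u v p uk vk uv pn np.
  split; first by case: ifP => _; apply: cls_lt; lia.
  by do 2 case: ifP; try lia.
- move=> u v p q uk vk uv pq qn qe np nq.
  have := @cls_neq_sym k u v k2 uk vk uv.
  by do 2 case: ifP; lia.
- move=> u v w p q uk vk wk uv uw vw pn qn pq np nq.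
  have := @cls_inj k u v w k2 uk vk wk uv uw vw.
  by do 2 case: ifP; lia.
Qed.

Ltac compare_to p a := case: (ltngtP p a) => //= ?; try (exfalso; lia).
Ltac compare_to4 p a b c d :=
  compare_to p a; compare_to p b; compare_to p c; compare_to p d.
Ltac compare_to6 p a b c d e f :=
  compare_to4 p a b c d; compare_to p e; compare_to p f.

(* In the ball of radius m/2 around [u], each half-edge gets a new outermost
   point, coloured by its class.  A further point is inserted just outside the ball
   and coloured by a third class [d u v]: at [u] this colour occurs only at the
   largest distance on another edge, so the two points are too far apart to clash. *)
Lemma scheme_extend_mid k m n N c d (h := m./2) (H := uphalf m) : 4 < k ->
  H.*2 < n -> n <= m.+1.*2 ->
  (forall u v, u < k -> v < k -> u != v ->
    [/\ d u v < k.-1, d u v <> d v u, d u v <> cls k u v & d u v <> cls k v u]) ->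
  scheme k m m n N c ->
  exists c', scheme k m.+2 m.+2 (n + 4) (N + k.-1) c'.
Proof.
move=> k4 Hn nm dP S.
have [hH [hleH Hleh]] : h + H = m /\ h <= H /\ H <= h.+1 by rewrite /h /H; lia.
move: h H hH hleH Hleh Hn => h H hH hleH Hleh Hn.
(* [b] and [a] mirror [h.+1] and [H.+2] in a word of length [n + 4]; sums avoid truncated
   subtraction. *)
have [b bE] : exists b, b + h = n + 3 by exists (n + 3 - h); lia.
have [a aE] : exists a, a + H = n + 2 by exists (n + 2 - H); lia.
eexists; apply: (scheme_insert
  (isnew := fun p => [|| p == h.+1, p == H.+2, p == a | p == b])
  (old := fun p => p - (h.+1 < p) - (H.+2 < p) - (a < p) - (b < p))
  (g := fun u v p => if p == h.+1 then cls k u v else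
     if p == H.+2 then d u v else
     if p == a then d v u else cls k v u) S) => //.
- by lia.
- by move=> p; lia.
- by move=> p pn; compare_to4 p h.+1 H.+2 a b; move=> _;
  compare_to4 (n + 4 - p) h.+1 H.+2 a b; lia.
(* Two old points [m.+2] apart must have two inserted points between them; the bound [n <= m.+1.*2]
   ensures this. *)
- move=> p q pq qn qe; compare_to4 p h.+1 H.+2 a b; move=> _;
  compare_to4 q h.+1 H.+2 a b; lia.
- move=> p q p0 q0 pn qn qe; compare_to4 p h.+1 H.+2 a b; move=> _;
  compare_to4 q h.+1 H.+2 a b; lia.
- move=> u v p uk vk uv pn; have [d1 d2 d3 d4] := dP u v uk vk uv.
  have [e1 _ _ _] := dP v u vk uk ltac:(by rewrite eq_sym).
  have [c1 c2] : cls k u v < k.-1 /\ cls k v u < k.-1 by split; apply: cls_lt; lia.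
  move=> np; split; first by do 3 case: ifP => //.
  move: np.
  compare_to4 p h.+1 H.+2 a b; move=> _;
   compare_to4 (n + 4 - p) h.+1 H.+2 a b.
- move=> u v p q uk vk uv pq qn qe.
  have [d1 d2 d3 d4] := dP u v uk vk uv.
  have [e1 e2 e3 e4] := dP v u vk uk ltac:(by rewrite eq_sym).
  have := @cls_neq_sym k u v ltac:(lia) uk vk uv.
  compare_to4 p h.+1 H.+2 a b; move=> ? _;
  compare_to4 q h.+1 H.+2 a b; move=> _; lia.
- move=> u v w p q uk vk wk uv uw vw pn qn pq.
  have := @cls_inj k u v w ltac:(lia) uk vk wk uv uw vw.
  compare_to4 p h.+1 H.+2 a b; move=> ? _;
  compare_to4 q h.+1 H.+2 a b; move=> _; lia.
Qed.

(* For K_4 the two ends of an edge leave only one further class, so each class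
   receives two new colours.  On the half-edge of class [j] at [u], [lo u j] goes to
   the inner inserted position and [hi u j] to the outer one; [flip] is chosen so
   that they are swapped between the ends of any edge whose third class is [j].
   Hence [hi u j] and [hi v j] differ, and can follow the two balls on that edge. *)
Definition third (u v : nat) := 3 - cls 4 u v - cls 4 v u.

Definition flip (u j : nat) : bool :=
  match j with 0 => u < 2 | 1 => u == 3 | _ => u == 0 end.

Definition hi (u j : nat) := j + (if flip u j then 3 else 0).
Definition lo (u j : nat) := j + (if flip u j then 0 else 3).

Lemma hi_lo_edge u v : u < 4 -> v < 4 -> u != v ->
  let s := [:: lo u (cls 4 u v); hi u (cls 4 u v); hi u (third u v);
            hi v (third u v); hi v (cls 4 v u); lo v (cls 4 v u)] in
  uniq s && all (gtn 6) s && (third v u == third u v).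
Proof. by move: u v => [|[|[|[|u]]]] [|[|[|[|v]]]]. Qed.

(** [hi u (third u v)] may equal [hi u (cls 4 u w)]: these will sit at distances [H.+3] and [h.+2]
    from [u], so [m + 5] apart. Hence it is separated from [lo] only. *)
Lemma hi_lo_star u v w : u < 4 -> v < 4 -> w < 4 -> u != v -> u != w -> v != w ->
  uniq [:: lo u (cls 4 u v); hi u (cls 4 u v); lo u (cls 4 u w); hi u (cls 4 u w)]
  && uniq [:: hi u (third u v); lo u (cls 4 u w)].
Proof.
by move: u v w => [|[|[|[|u]]]] [|[|[|[|v]]]] [|[|[|[|w]]]].
Qed.

Lemma scheme_extend_flip m n N c (h := m./2) (H := uphalf m) :
  H.*2 < n -> n <= m + H + 1 ->
  scheme 4 m m n N c ->
  exists c', scheme 4 m.+4 m.+4 (n + 6) (N + 6) c'.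
Proof.
move=> Hn nm S.
have [hH [hleH Hleh]] : h + H = m /\ h <= H /\ H <= h.+1 by rewrite /h /H; lia.
move: h H hH hleH Hleh Hn nm => h H hH hleH Hleh Hn nm.
(* [g] solves [g.+1 + x = m + 5]: the point [x] of one edge and the innermost inserted point of
   another edge at the same end are just out of range. Below, [x], [y], [z] mirror [H.+3], [h.+2],
   [g.+1]. *)
have [g gE] : exists g, g + n = m + H + 1 by exists (m + H + 1 - n); lia.
have [x xE] : exists x, x + H = n + 3 by exists (n + 3 - H); lia.
have [y yE] : exists y, y + h = n + 4 by exists (n + 4 - h); lia.
have [z zE] : exists z, z + g = n + 5 by exists (n + 5 - g); lia.
have gh : g <= h by lia.
eexists; apply: (scheme_insert
  (isnew := fun p =>
    [|| p == g.+1, p == h.+2, p == H.+3, p == x, p == y | p == z])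
  (old := fun p => p - (g.+1 < p) - (h.+2 < p) - (H.+3 < p)
    - (x < p) - (y < p) - (z < p))
  (g := fun u v p => if p == g.+1 then lo u (cls 4 u v) else
     if p == h.+2 then hi u (cls 4 u v) else
     if p == H.+3 then hi u (third u v) else
     if p == x then hi v (third u v) else
     if p == y then hi v (cls 4 v u) else lo v (cls 4 v u)) S) => //.
- by lia.
- by move=> p; lia.
- by move=> p pn; compare_to6 p g.+1 h.+2 H.+3 x y z; move=> _;
  compare_to6 (n + 6 - p) g.+1 h.+2 H.+3 x y z; lia.
- move=> p q pq qn qe; compare_to6 p g.+1 h.+2 H.+3 x y z; move=> _;
  compare_to6 q g.+1 h.+2 H.+3 x y z; lia.
- move=> p q p0 q0 pn qn qe; compare_to6 p g.+1 h.+2 H.+3 x y z; move=> _;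
  compare_to6 q g.+1 h.+2 H.+3 x y z; lia.
- move=> u v p uk vk uv pn.
  case/andP: (hi_lo_edge uk vk uv) => /andP[/= _ +] /eqP ->.
  case/and5P=> ? ? ? ? /and3P[? ? _] np.
  split; first by do 5 case: ifP => //.
  move: np.
  compare_to6 p g.+1 h.+2 H.+3 x y z; move=> _;
  compare_to6 (n + 6 - p) g.+1 h.+2 H.+3 x y z.
- move=> u v p q uk vk uv pq qn qe.
  have /andP[/andP[+ _] _] := hi_lo_edge uk vk uv.
  move: (lo u _) (hi u (cls 4 u v)) (hi u _) (hi v (third u v)) (hi v _) (lo v _).
  move=> c1 c2 c3 c4 c5 c6 U {uv}.
  compare_to6 p g.+1 h.+2 H.+3 x y z; move=> _;
  compare_to6 q g.+1 h.+2 H.+3 x y z; move=> _ E;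
  by move: U; rewrite E /= !inE eqxx ?orbT ?andbF.
- move=> u v w p q uk vk wk uv uw vw pn qn pq.
  have /andP[U aN] := hi_lo_star uk vk wk uv uw vw.
  have wv : w != v by rewrite eq_sym.
  have /andP[_ bN] := hi_lo_star uk wk vk uw uv wv.
  move: (lo u (cls 4 u v)) (hi u (cls 4 u v)) (lo u (cls 4 u w)) (hi u (cls 4 u w))
    (hi u (third u v)) (hi u (third u w)) U aN bN => c1 c2 c3 c4 a b U aN bN {uv uw vw wv}.
  compare_to6 p g.+1 h.+2 H.+3 x y z; move=> _;
  compare_to6 q g.+1 h.+2 H.+3 x y z; move=> _ E;
  by [move: U; rewrite E /= !inE eqxx ?orbT ?andbF |
      move: aN; rewrite E /= inE eqxx | move: bN; rewrite E /= inE eqxx].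
Qed.

(** * Colours outside a given list *)

Definition fresh (n : nat) (A : seq nat) (i : nat) :=
  nth 0 [seq j <- iota 0 n | j \notin A] i.

Lemma size_fresh n A : n <= size [seq j <- iota 0 n | j \notin A] + size A.
Proof.
rewrite size_filter -{1}(size_iota 0 n) -(count_predC (mem A)) addnC leq_add2l.
rewrite -size_filter; apply: uniq_leq_size; first exact/filter_uniq/iota_uniq.
by move=> j; rewrite mem_filter => /andP[].
Qed.

Lemma freshP n A i : i + size A < n -> fresh n A i < n /\ fresh n A i \notin A.
Proof.
move=> iA; have : fresh n A i \in [seq j <- iota 0 n | j \notin A].
  by apply: mem_nth; rewrite -(ltn_add2r (size A)) (leq_trans iA) ?size_fresh.
by rewrite mem_filter mem_iota => /andP[-> /andP[_ ->]].
Qed.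

Lemma fresh_neq n A i j : i + size A < n -> j + size A < n -> i != j ->
  fresh n A i != fresh n A j.
Proof.
move=> iA jA ij; have sA l : l + size A < n -> l < size [seq j <- iota 0 n | j \notin A].
  by move=> lA; rewrite -(ltn_add2r (size A)) (leq_trans lA) ?size_fresh.
by rewrite nth_uniq ?filter_uniq ?iota_uniq ?sA.
Qed.

(** Makes a choice that avoids data of both ends of an edge the same when read from either end. *)
Lemma eq_fresh n A B i : A =i B -> fresh n A i = fresh n B i.
Proof. by move=> AB; congr nth; apply: eq_filter => j; rewrite AB. Qed.

(** * Derangements of the other vertices, one for each vertex *)

(* [skip n u] is a cyclic shift of the vertices other than [u], upwards for even
   [u] and downwards for odd [u]; for even [n] this makes [skip n u v] and
   [skip n v u] differ.  For odd [k], [der] inserts the last vertex just after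
   [nxt n u] in the cycle of each other [u]. *)
Definition nxt n x := if x.+1 == n then 0 else x.+1.
Definition prv n x := if x == 0 then n.-1 else x.-1.
Definition skip n u v :=
  if odd u then (if prv n v == u then prv n u else prv n v)
  else (if nxt n v == u then nxt n u else nxt n v).

Definition der k u v :=
  let n := k - odd k in
  if u == n then nxt n v
  else if v == n then skip n u (nxt n u)
  else if odd k && (v == nxt n u) then n else skip n u v.

Ltac split_ifs :=
  repeat match goal with |- context[if ?b then _ else _] =>
    lazymatch b with context[if _ then _ else _] => fail | _ =>
    case: (boolP b) => /= ?; try (exfalso; lia) end
  end.

Lemma nxtP n u : 2 < n -> u < n ->
  [/\ nxt n u < n, nxt n u != u & nxt n (nxt n u) != u].
Proof. by move=> n2 un; rewrite /nxt; split_ifs; split; lia. Qed.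

Lemma nxt_inj n u v : u < n -> v < n -> u != v -> nxt n u != nxt n v.
Proof. by move=> un vn uv; rewrite /nxt; split_ifs; lia. Qed.

Lemma skipP n u v : 2 < n -> u < n -> v < n -> u != v ->
  [/\ skip n u v < n, skip n u v != u & skip n u v != v].
Proof.
by move=> n2 un vn uv; rewrite /skip /nxt /prv; split_ifs; split; lia.
Qed.

Lemma skip_neq_sym n u v : 2 < n -> ~~ odd n -> u < n -> v < n -> u != v ->
  skip n u v != skip n v u.
Proof.
by move=> n2 on un vn uv; rewrite /skip /nxt /prv; split_ifs; lia.
Qed.

Lemma skip_inj n u v w : 2 < n -> u < n -> v < n -> w < n ->
  u != v -> u != w -> v != w -> skip n u v != skip n u w.
Proof.
move=> n2 un vn wn uv uw vw; rewrite /skip; case: (odd u).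
  rewrite /prv; split_ifs; lia.
rewrite /nxt; split_ifs; lia.
Qed.

Lemma derP k u v : 3 < k -> u < k -> v < k -> u != v ->
  [/\ der k u v < k, der k u v != u & der k u v != v].
Proof.
move=> k3 uk vk uv; rewrite /der; set n := k - odd k.
have [n2 nk nE] : [/\ 2 < n, n <= k & k = n + odd k] by rewrite /n; split; lia.
case: (eqVneq u n) => [un|un]; first by have [] := @nxtP n v n2; [lia|split; lia].
have un' : u < n by lia.
have [nu1 nu2 nu3] := nxtP n2 un'.
case: (eqVneq v n) => [vn|vn].
  have unu : u != nxt n u by rewrite eq_sym.
  have [s1 s2 s3] := skipP n2 un' nu1 unu.
  by split; lia.
case: ifP => [/andP[ok /eqP ->]|_]; first by split; lia.
have vn' : v < n by lia.
have [s1 s2 s3] := skipP n2 un' vn' uv.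
by split; lia.
Qed.

Lemma der_neq_sym k u v : 3 < k -> u < k -> v < k -> u != v ->
  der k u v != der k v u.
Proof.
move=> k3; wlog vu : u v / v < u.
  move=> W uk vk uv; case: (ltngtP u v) uv => // [uv|vu] _; last by apply: W => //; lia.
  by rewrite eq_sym; apply: W => //; lia.
move=> uk vk uv; rewrite /der; set n := k - odd k.
have [n2 nk nE] : [/\ 2 < n, n <= k & k = n + odd k] by rewrite /n; split; lia.
have on : ~~ odd n by lia.
have vn : v < n by lia.
have [nv1 nv2 nv3] := nxtP n2 vn.
rewrite (negbTE (_ : v != n)); last by lia.
case: (eqVneq u n) => [un|un].
  have vnv : v != nxt n v by rewrite eq_sym.
  by have [_ _ s3] := skipP n2 vn nv1 vnv; rewrite eq_sym.
have un' : u < n by lia.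
have [s1 _ _] := skipP n2 un' vn uv.
have vu' : v != u by rewrite eq_sym.
have [s2 _ _] := skipP n2 vn un' vu'.
case: ifP => [/andP[_ /eqP v_u]|_]; case: ifP => [/andP[_ /eqP u_v]|_].
- by move: nv3; rewrite -u_v -v_u eqxx.
- by lia.
- by lia.
- exact: skip_neq_sym.
Qed.

Lemma der_inj k u v w : 3 < k -> u < k -> v < k -> w < k ->
  u != v -> u != w -> v != w -> der k u v != der k u w.
Proof.
move=> k3 uk; wlog wv : v w / w < v.
  move=> W vk wk uv uw vw; case: (ltngtP v w) vw => // [vw|wv] _; last by apply: W => //; lia.
  by rewrite eq_sym; apply: W => //; lia.
move=> vk wk uv uw vw; rewrite /der; set n := k - odd k.
have [n2 nk nE] : [/\ 2 < n, n <= k & k = n + odd k] by rewrite /n; split; lia.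
case: (eqVneq u n) => [un|un]; first by apply: nxt_inj; lia.
have un' : u < n by lia.
have wn : w < n by lia.
have [nu1 nu2 nu3] := nxtP n2 un'.
have [s1 _ _] := skipP n2 un' wn uw.
have unu : u != nxt n u by rewrite eq_sym.
have [s2 _ _] := skipP n2 un' nu1 unu.
rewrite (negbTE (_ : w != n)); last by lia.
case: (eqVneq v n) => [vn|vn].
  case: ifP => [_|/negbT]; first by lia.
  by rewrite negb_and => wu; apply: skip_inj => //; lia.
have vn' : v < n by lia.
have [s3 _ _] := skipP n2 un' vn' uv.
case: ifP => [/andP[_ /eqP v_u]|_]; case: ifP => [/andP[_ /eqP u_v]|_].
- by lia.
- by lia.
- by lia.
- exact: skip_inj.
Qed.

(** * Explicit short words *)

Lemma scheme_path1 k : scheme k 0 0 1 1 (fun _ _ _ => 0).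
Proof. by split=> //; lia. Qed.

Lemma scheme_path2 k : scheme k 1 1 2 2 (fun _ _ p => p == 1).
Proof. by split=> //; lia. Qed.

(** Classes next to the ends, and a third class in the middle, which exists since [k.-1 >= 3]. *)
Lemma scheme_path4 k : 3 < k -> exists c, scheme k 3 2 4 k c.
Proof.
move=> k3.
exists (fun u v => nth 0 [:: 0; (cls k u v).+1;
  (fresh k.-1 [:: cls k u v; cls k v u] 0).+1; (cls k v u).+1; 0]).
split=> //.
- move=> u v p uk vk uv pn.
  have [//= fk _] := @freshP k.-1 [:: cls k u v; cls k v u] 0 ltac:(rewrite /=; lia).
  have c1 := @cls_lt k u v ltac:(lia); have c2 := @cls_lt k v u ltac:(lia).
  by move: p pn => [|[|[|[|[|p]]]]] //= _; lia.
- move=> u v p uk vk uv.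
  rewrite (@eq_fresh _ [:: cls k v u; cls k u v] [:: cls k u v; cls k v u]).
    by move: p => [|[|[|[|[|p]]]]].
  by move=> j; rewrite !inE orbC.
- move=> u v p q uk vk uv pq qn qe.
  have [//= _] := @freshP k.-1 [:: cls k u v; cls k v u] 0 ltac:(rewrite /=; lia).
  have := @cls_neq_sym k u v ltac:(lia) uk vk uv.
  rewrite !inE.
  by move: p q pq qn qe => [|[|[|[|[|p]]]]] [|[|[|[|[|q]]]]] //=; lia.
- move=> u v w [|[|p]] [|[|q]] uk vk wk uv uw vw //= _ _ _ _ pq; try lia.
  by have := @cls_inj k u v w ltac:(lia) uk vk wk uv uw vw; lia.
Qed.

(** Around [u] the letters at distance 1 are distinct and avoid [u.+1], which occurs at distance 2
    on every edge; those occurrences are 4 apart, beyond [m = 3]. *)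
Lemma scheme_path5 k : 3 < k -> exists c, scheme k 4 3 5 k.+1 c.
Proof.
move=> k3.
exists (fun u v => nth 0 [:: 0; (der k u v).+1; u.+1; v.+1; (der k v u).+1; 0]).
split=> //.
- move=> u v p uk vk uv pn.
  have [a1 a2 a3] := derP k3 uk vk uv.
  have [b1 b2 b3] := derP k3 vk uk ltac:(by rewrite eq_sym).
  by move: p pn => [|[|[|[|[|[|p]]]]]] //= _; lia.
- by move=> u v [|[|[|[|[|[|p]]]]]].
- move=> u v p q uk vk uv pq qn qe.
  have [a1 a2 a3] := derP k3 uk vk uv.
  have [b1 b2 b3] := derP k3 vk uk ltac:(by rewrite eq_sym).
  have ab := der_neq_sym k3 uk vk uv.
  by move: p q pq qn qe => [|[|[|[|[|[|p]]]]]] [|[|[|[|[|[|q]]]]]] //=; lia.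
- move=> u v w p q uk vk wk uv uw vw p0 q0 pn qn pq.
  have [a1 a2 a3] := derP k3 uk vk uv.
  have [b1 b2 b3] := derP k3 uk wk uw.
  have := der_inj k3 uk vk wk uv uw vw.
  by move: p q p0 q0 pn qn pq => [|[|[|p]]] [|[|[|q]]] //=; lia.
Qed.

(** The word of [scheme_path5] with a middle letter added; its four vertex letters leave a fifth one
    since [k > 4]. *)
Lemma scheme_path6 k : 4 < k -> exists c, scheme k 5 3 6 k.+1 c.
Proof.
move=> k4; have k3 : 3 < k by lia.
pose w u v := fresh k [:: u; v; der k u v; der k v u] 0.
have wP u v : w u v < k /\ w u v \notin [:: u; v; der k u v; der k v u].
  by apply: freshP => /=; lia.
exists (fun u v => nth 0
  [:: 0; (der k u v).+1; u.+1; (w u v).+1; v.+1; (der k v u).+1; 0]).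
split=> //.
- move=> u v p uk vk uv pn; have [w1 _] := wP u v.
  have [a1 a2 a3] := derP k3 uk vk uv.
  have [b1 b2 b3] := derP k3 vk uk ltac:(by rewrite eq_sym).
  by move: p pn => [|[|[|[|[|[|[|p]]]]]]] //= _; lia.
- move=> u v p uk vk uv pn.
  have -> : w v u = w u v.
    apply: eq_fresh => j; rewrite !inE.
    by case: (j == u); case: (j == v); case: (j == der k u v); case: (j == der k v u).
  by move: p pn => [|[|[|[|[|[|[|p]]]]]]].
- move=> u v p q uk vk uv pq qn qe; have [_] := wP u v; rewrite !inE !negb_or.
  have [a1 a2 a3] := derP k3 uk vk uv.
  have [b1 b2 b3] := derP k3 vk uk ltac:(by rewrite eq_sym).
  have ab := der_neq_sym k3 uk vk uv.
  by move: p q pq qn qe => [|[|[|[|[|[|[|p]]]]]]] [|[|[|[|[|[|[|q]]]]]]] //=; lia.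
- move=> u v z p q uk vk wk uv uw vw p0 q0 pn qn pq.
  have [a1 a2 a3] := derP k3 uk vk uv.
  have [b1 b2 b3] := derP k3 uk wk uw.
  have := der_inj k3 uk vk wk uv uw vw.
  by move: p q p0 q0 pn qn pq => [|[|[|p]]] [|[|[|q]]] //=; lia.
Qed.

(** The letters [v.+1] and [u.+1] recur after four steps, beyond [e = 3]. Comparing [u] and [v]
    orders the two middle letters consistently from both ends. *)
Lemma scheme_path7 k : 3 < k -> exists c, scheme k 3 3 7 k.+1 c.
Proof.
move=> k3.
pose w (u v i : nat) : nat := fresh k [:: u; v] i.
have wP (u v : nat) (i : bool) : w u v i < k /\ w u v i \notin [:: u; v].
  by apply: freshP => /=; lia.
have wC (u v i : nat) : w v u i = w u v i.
  by apply: eq_fresh => j; rewrite !inE orbC.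
have ww (u v : nat) : w u v false != w u v true by apply: fresh_neq => /=; lia.
exists (fun u v => nth 0
  [:: 0; v.+1; u.+1; (w u v (v < u)).+1; (w u v (u < v)).+1; v.+1; u.+1; 0]).
split=> //.
- move=> u v p uk vk uv pn; have [w1 _] := wP u v (u < v); have [w2 _] := wP u v (v < u).
  move: (w u v (u < v)) (w u v (v < u)) w1 w2 => x y x1 y1 {wP wC ww}.
  by move: p pn => [|[|[|[|[|[|[|[|p]]]]]]]] //= _; lia.
- by move=> u v p uk vk uv pn; rewrite !(wC u v); move: p pn => [|[|[|[|[|[|[|[|p]]]]]]]].
- move=> u v p q uk vk uv pq qn qe.
  have [_ +] := wP u v (u < v); have [_ +] := wP u v (v < u); rewrite !inE !negb_or.
  have : w u v (u < v) != w u v (v < u).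
    by have := ww u v; case: (ltngtP u v) uv => // _ _; rewrite eq_sym.
  move: (w u v (u < v)) (w u v (v < u)) => x y {wP wC ww} xy /andP[yu yv] /andP[xu xv].
  move: p q qn qe pq => [|[|[|[|[|[|[|[|p]]]]]]]] [|[|[|[|[|[|[|[|q]]]]]]]] //= _ _ _; lia.
- move=> u v z p q uk vk wk uv uw vw p0 q0 pn qn pq.
  by move: p q p0 q0 pn qn pq => [|[|[|p]]] [|[|[|q]]] //=; lia.
Qed.

(** * Tables for K_4, checked by computation *)

Definition schemeb (k e m n N : nat) (c : nat -> nat -> nat -> nat) : bool :=
  let I := iota 0 n.+1 in
  all (fun u => all (fun v => (u != v) ==>
    [&& all (fun p => (c u v p < N) && (c v u p == c u v (n - p))) I,
        all (fun p => all (fun q =>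
          (p < q) && (q <= p + e) ==> (c u v p != c u v q)) I) I &
        all (fun w => (u != w) && (v != w) ==>
          (c u v 0 == c u w 0) &&
          all (fun p => all (fun q => [&& 0 < p, 0 < q & p + q <= m] ==>
            (c u v p != c u w q)) I) I) (iota 0 k)]) (iota 0 k)) (iota 0 k).

Lemma schemebP k e m n N c : schemeb k e m n N c -> scheme k e m n N c.
Proof.
have inI l x : x < l -> x \in iota 0 l by rewrite mem_iota.
have get l (P : pred nat) x : all P (iota 0 l) -> x < l -> P x.
  by move=> /allP Pl /(inI l) /Pl.
move=> S.
have S' u v : u < k -> v < k -> u != v -> _ :=
  fun uk vk uv => implyP (get _ _ _ (get _ _ _ S uk) vk) uv.
split.
- move=> u v p uk vk uv pn; case/and3P: (S' u v uk vk uv) => P1 _ _.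
  by case/andP: (get _ _ p P1 pn).
- move=> u v p uk vk uv pn; case/and3P: (S' u v uk vk uv) => P1 _ _.
  by case/andP: (get _ _ p P1 pn) => _ /eqP.
- move=> u v w uk vk wk uv uw; case: (eqVneq v w) => [-> //|vw].
  case/and3P: (S' u v uk vk uv) => _ _ P3.
  by have /implyP/(_ (introT andP (conj uw vw)))/andP[/eqP] := get _ _ w P3 wk.
- move=> u v p q uk vk uv pq qn qe; case/and3P: (S' u v uk vk uv) => _ P2 _.
  have pn : p < n.+1 by lia.
  by have := get _ _ q (get _ _ p P2 pn) qn; rewrite /= pq qe => /eqP.
- move=> u v w p q uk vk wk uv uw vw p0 q0 pn qn pqm.
  case/and3P: (S' u v uk vk uv) => _ _ P3.
  have /implyP/(_ (introT andP (conj uw vw)))/andP[_ P4] := get _ _ w P3 wk.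
  by have := get _ _ q (get _ _ p P4 pn) qn; rewrite /= p0 q0 pqm => /eqP.
Qed.

(* The rows are the edges 01, 02, 12, 03, 13, 23. *)
Definition table (n : nat) (rows : seq (seq nat)) (u v p : nat) :=
  if u < v then nth 0 (nth [::] rows ('C(v, 2) + u)) p
  else nth 0 (nth [::] rows ('C(u, 2) + v)) (n - p).

(* The colourings for (m, n) = (3, 6) and (5, 9) were found by computer search. *)
Lemma scheme_K4_3_6 : exists c, scheme 4 3 3 6 5 c.
Proof.
exists (table 6 [:: [:: 1; 4; 0; 2; 3; 1; 0]; [:: 1; 3; 0; 2; 1; 3; 4];
  [:: 0; 4; 3; 2; 1; 0; 4]; [:: 1; 2; 0; 3; 4; 1; 2];
  [:: 0; 2; 3; 1; 4; 0; 2]; [:: 4; 2; 1; 0; 4; 3; 2]]).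
by apply: schemebP; vm_compute.
Qed.

(** With [e = 7] only the two ends of a word may agree, so [scheme_extend_low] applies and yields
    every [n = m + 3] with [m] odd and at least 5. *)
Lemma scheme_K4_5_8 : exists c, scheme 4 7 5 8 8 c.
Proof.
exists (table 8 [:: [:: 0; 3; 5; 1; 7; 2; 6; 4; 0]; [:: 0; 4; 6; 1; 7; 3; 5; 2; 0];
  [:: 0; 1; 7; 2; 5; 3; 6; 4; 0]; [:: 0; 2; 7; 1; 5; 4; 6; 3; 0];
  [:: 0; 3; 5; 2; 6; 4; 7; 1; 0]; [:: 0; 1; 7; 3; 6; 4; 5; 2; 0]]).
by apply: schemebP; vm_compute.
Qed.

Lemma scheme_K4_5_9 : exists c, scheme 4 5 5 9 8 c.
Proof.
exists (table 9 [:: [:: 3; 5; 6; 4; 0; 1; 3; 2; 5; 7];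
  [:: 3; 1; 0; 4; 2; 7; 6; 5; 1; 0]; [:: 7; 0; 1; 3; 4; 5; 6; 7; 2; 0];
  [:: 3; 7; 2; 4; 6; 5; 0; 1; 7; 3]; [:: 7; 6; 4; 3; 1; 5; 0; 2; 6; 3];
  [:: 0; 4; 3; 6; 7; 2; 0; 5; 4; 3]]).
by apply: schemebP; vm_compute.
Qed.

(** * Long words for K_4 from its perfect matchings *)

(* A proper 3-edge-colouring of K_4; the diagonal entries are junk. *)
Definition matching (u v : nat) :=
  nth 0 (nth [::] [:: [:: 0; 0; 1; 2]; [:: 0; 0; 2; 1]; [:: 1; 2; 0; 0]; [:: 2; 1; 0; 0]] u) v.
(** The smaller of the two vertices off the edge; the larger is [other2], from 0 + 1 + 2 + 3 = 6. *)
Definition other1 (u v : nat) :=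
  nth 0 (nth [::] [:: [:: 0; 2; 1; 1]; [:: 2; 0; 0; 0]; [:: 1; 0; 0; 0]; [:: 1; 0; 0; 0]] u) v.
Definition other2 (u v : nat) := 6 - u - v - other1 u v.

Lemma matching_edge u v : u < 4 -> v < 4 -> u != v ->
  let w := other1 u v in let z := other2 u v in
  [/\ w < 4, z < 4, matching v u = matching u v, other1 v u = w & other2 v u = z] /\
  [/\ uniq [:: u; v; w; z], matching u v != matching u w,
    matching u v != matching v w & matching u w != matching v w] /\
  matching v w = matching u z.
Proof. by move: u v => [|[|[|[|u]]]] [|[|[|[|v]]]]. Qed.

Lemma matching_lt3 u v : matching u v < 3.
Proof. by move: u v => [|[|[|[|u]]]] [|[|[|[|v]]]]; rewrite /matching /= ?nth_nil. Qed.

Lemma matching_star u v w : u < 4 -> v < 4 -> w < 4 -> u != v -> u != w -> v != w ->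
  matching u v != matching u w.
Proof. by move: u v w => [|[|[|[|u]]]] [|[|[|[|v]]]] [|[|[|[|w]]]]. Qed.

(** Reading each point from its nearer end makes the word symmetric; at a midpoint the smaller end
    decides. *)
Definition fold_half (n : nat) (half : nat -> nat -> nat -> nat) (u v p : nat) :=
  if (p.*2 < n) || (p.*2 == n) && (u < v) then half u v p else half v u (n - p).

Lemma scheme_fold k e m n N half : m < n ->
  (forall u v p, u < k -> v < k -> u != v -> p.*2 <= n -> half u v p < N) ->
  (forall u v w, u < k -> v < k -> w < k -> u != v -> u != w ->
    half u v 0 = half u w 0) ->
  (forall u v p q, u < k -> v < k -> u != v -> p < q -> q.*2 <= n -> q <= p + e ->
    half u v p <> half u v q) ->
  (forall u v p q, u < k -> v < k -> u != v -> p.*2 <= n -> q.*2 <= n ->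
    p + q < n -> n <= p + q + e -> half u v p <> half v u q) ->
  (forall u v w p q, u < k -> v < k -> w < k -> u != v -> u != w -> v != w ->
    0 < p -> p <= q -> q.*2 <= n -> p + q <= m -> half u v p <> half u w q) ->
  (forall u v w p q, u < k -> v < k -> w < k -> u != v -> u != w -> v != w ->
    0 < p -> p.*2 <= n -> q.*2 <= n -> p + n <= m + q -> half u v p <> half w u q) ->
  scheme k e m n N (fold_half n half).
Proof.
move=> mn hlt hc hl ha hs hx; split.
- move=> u v p uk vk uv pn; rewrite /fold_half.
  by case: ifP => ?; apply: hlt; rewrite // 1?eq_sym //; lia.
- move=> u v p uk vk uv pn; rewrite /fold_half subKn //.
  by case: ifP => ?; case: ifP => ? //; lia.
- move=> u v w uk vk wk uv uw; rewrite /fold_half.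
  by rewrite (_ : 0.*2 < n) //=; [apply: hc | lia].
- move=> u v p q uk vk uv pq qn qe; rewrite /fold_half.
  have vu : v != u by rewrite eq_sym.
  case: ifP => ?; case: ifP => ?.
  + by apply: hl => //; lia.
  + by apply: ha => //; lia.
  + by lia.
  + by apply/nesym; apply: hl => //; lia.
(* Once [p <= q], the bound [p + q <= m < n] puts [p] in the half nearer to [u]; only [q] may lie
   past the middle. *)
- suff W u v w p q : u < k -> v < k -> w < k -> u != v -> u != w -> v != w ->
    0 < p -> p <= q -> p <= n -> q <= n -> p + q <= m ->
    fold_half n half u v p <> fold_half n half u w q.
    move=> u v w p q uk vk wk uv uw vw p0 q0 pn qn pqm.
    case: (leqP p q) => pq; first exact: W.
    by apply/nesym; apply: W => //; rewrite 1?eq_sym //; lia.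
  move=> uk vk wk uv uw vw p0 pq pn qn pqm; rewrite /fold_half.
  rewrite (_ : p.*2 < n) /=; last by lia.
  case: ifP => ?; first by apply: hs => //; lia.
  by apply: hx => //; lia.
Qed.

(* Both halves of an edge use the colours of its perfect matching, in opposite
   orders, so that equal colours are n - (r + 1) apart. *)
Definition side (r u v i : nat) :=
  1 + matching u v + 3 * (if u < v then i.-1 else r - i).

Lemma side_lt r u v i : 0 < i -> i <= r -> side r u v i < 1 + 3 * r.
Proof.
by move=> i0 ir; have := matching_lt3 u v; rewrite /side; case: ifP; lia.
Qed.

Lemma side_eq r u v w z i j : side r u v i = side r w z j ->
  matching u v = matching w z /\
  (if u < v then i.-1 else r - i) = (if w < z then j.-1 else r - j).
Proof.
rewrite /side; have := matching_lt3 u v; have := matching_lt3 w z.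
by move: (if _ then _ else _) (if _ then _ else _) => a b; lia.
Qed.

(* Beyond the ball of radius [r] around [u], the colours of another edge at [u]
   are repeated in reverse order. *)
Definition half_even (r u v p : nat) :=
  if p == 0 then 0 else if p <= r then side r u v p
  else side r u (other1 u v) (r.*2.+1 - p).

(** Equal letters of opposite halves other than the centre lie in the two balls at positions of sum
    [r.+1], hence at least [2 * r + 1] apart when [3 * r + 2 <= n]. The bound [n <= 4 * r + 1] keeps
    the reversed index [r.*2.+1 - p] positive. *)
Lemma scheme_long_even r n : 0 < r -> 3 * r + 2 <= n -> n <= 4 * r + 1 ->
  scheme 4 r.*2 r.*2 n (1 + 3 * r) (fold_half n (half_even r)).
Proof.
move=> r0 rn nr; apply: scheme_fold; first by lia.
- move=> u v p uk vk uv pn; rewrite /half_even.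
  have /= [[w1 _ _ _ _] _] := matching_edge uk vk uv.
  by case: ifP => // ?; case: ifP => ?; apply: side_lt => //; lia.
- by [].
- move=> u v p q uk vk uv pq qn qe; rewrite /half_even.
  have /= [[w1 _ _ _ _] [[_ m1 _ _] _]] := matching_edge uk vk uv.
  have -> /= : (q == 0) = false by lia.
  case: ifP => ?; first by case: ifP => ?; rewrite /side; lia.
  case: ifP => ?; case: ifP => ?; try lia; move=> /side_eq [] // E;
    try (by move: m1; rewrite E eqxx); case: (u < _) E; lia.
- move=> u v p q uk vk uv pn qn pq pqe; rewrite /half_even.
  have /= [[w1 _ mC oC _] [[_ m1 m2 m3] _]] := matching_edge uk vk uv.
  have uvC : (v < u) = ~~ (u < v) by lia.
  case: (boolP (p == 0)) => p0; case: (boolP (q == 0)) => q0 //=; try lia.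
  + by case: ifP => ?; rewrite /side; lia.
  + by case: ifP => ?; rewrite /side; lia.
  case: ifP => pl; case: ifP => ql; rewrite ?oC => /side_eq [] // E;
    try by exfalso; clear - E m1 m2 m3 mC; lia.
  by rewrite uvC; move: (u < v); clear - r0 rn nr p0 q0 pl ql pqe; case=> /=; lia.
- move=> u v w p q uk vk wk uv uw vw p0 pq qn pqm; rewrite /half_even.
  have /= [[x1 z1 _ _ _] [[U m1 m2 m3] m4]] := matching_edge uk wk uw.
  move: U; rewrite /= !inE !negb_or => /and4P[/and3P[? ux uz] ? ? _].
  have m5 := matching_star uk vk wk uv uw vw.
  have -> : (p == 0) = false by lia.
  have -> : (q == 0) = false by lia.
  have -> /= : p <= r by lia.
  case: ifP => qr /side_eq [] // E; first by lia.
  case: (eqVneq v (other1 u w)) => [->|vx]; last first.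
    by have := matching_star uk vk x1 uv ux vx; rewrite E eqxx.
  by move: (u < _); clear - p0 pq pqm qr; case; lia.
- move=> u v w p q uk vk wk uv uw vw p0 pn qn pqm; rewrite /half_even.
  have /= [[x1 z1 mC oC _] [[U m1 m2 m3] m4]] := matching_edge uk wk uw.
  move: U; rewrite /= !inE !negb_or => /and4P[/and3P[? ux uz] /andP[wx ?] ? _].
  have m5 := matching_star uk vk wk uv uw vw.
  have -> : (p == 0) = false by lia.
  have -> : (q == 0) = false by lia.
  have -> /= : p <= r by lia.
  case: ifP => qr; first by lia.
  rewrite oC => /side_eq [] // _.
  by move: (u < v) (w < _); clear - r0 rn p0 pn qn pqm qr; do 2 case; lia.
Qed.

(** One of the two vertices off the edge, different from the two ends of the edge. It serves at
    distance [r.*2.+1], where the reversed letters have run out. *)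
Definition pick (u v : nat) := if u < v then other1 u v else other2 u v.

Lemma pickP u v : u < 4 -> v < 4 -> u != v ->
  [/\ pick u v < 4, pick u v != u, pick u v != v & pick u v != pick v u].
Proof. by move: u v => [|[|[|[|u]]]] [|[|[|[|v]]]]. Qed.

(* The colour [u.+1] is missing from the ball of radius [r] around [u], hence is
   forced at distance [r.+1] from [u]; here it also occurs next to the other vertices. *)
Definition half_odd (r u v p : nat) :=
  if p == 0 then 0 else if p == 1 then v.+1 else if p == r.+1 then u.+1
  else if p == r.*2.+1 then (pick u v).+1
  else if p <= r then 4 + side r.-1 u v p.-1
  else 4 + side r.-1 u (other1 u v) (r.*2.+1 - p).

Lemma vertex_neq_side x r u v i : x < 4 -> x.+1 <> 4 + side r u v i.
Proof. by rewrite /side; lia. Qed.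

(** Vertex letters are at most 4 and matching letters at least 5, so they are compared separately,
    the latter as in [scheme_long_even] with [r.-1]. Equal letters of opposite halves other than the
    centre have positions of sum [r + 2], which [3 * r + 4 <= n] puts out of range. *)
Lemma scheme_long_odd r n : 0 < r -> 3 * r + 4 <= n -> n <= 4 * r + 3 ->
  scheme 4 r.*2.+1 r.*2.+1 n (2 + 3 * r) (fold_half n (half_odd r)).
Proof.
move=> r0 rn nr; apply: scheme_fold; first by lia.
- move=> u v p uk vk uv pn; rewrite /half_odd.
  have [y4 _ _ _] := pickP uk vk uv.
  do 4 (case: ifP => [_|?]; first by lia).
  by case: ifP => ?; rewrite -ltn_subRL; apply: leq_trans (@side_lt r.-1 _ _ _ _ _) _; lia.
- by [].
- move=> u v p q uk vk uv pq qn qe; rewrite /half_odd.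
  have /= [[w1 _ _ _ _] [[_ m1 _ _] _]] := matching_edge uk vk uv.
  have [y4 yu yv _] := pickP uk vk uv.
  have -> /= : (q == 0) = false by lia.
  have -> /= : (p == r.*2.+1) = false by lia.
  move: (pick u v) y4 yu yv => y y4 yu yv.
  case: ifP => p0; first by do 4 case: ifP => //.
  case: ifP => p1; first by
    case: ifP => ?; [lia | do 2 (case: ifP => [_|_]; first lia);
     case: ifP => _; exact: vertex_neq_side].
  case: ifP => pr; first by
    case: ifP => ?; [lia | case: ifP => ?; [lia | case: ifP => ?; [lia | case: ifP => _; exact: vertex_neq_side]]].
  case: (boolP (q == 1)) => q1 /=; first by lia.
  case: (boolP (q == r.+1)) => qr /=; first by case: ifP => _; apply/nesym; exact: vertex_neq_side.
  case: (boolP (q == r.*2.+1)) => qr2 /=;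
    first by case: ifP => _; apply/nesym; exact: vertex_neq_side.
  case: ifP => pl; case: ifP => ql; try lia; move=> /addnI /side_eq [] // E;
    try (by move: m1; rewrite E eqxx); move: (u < _); clear - p0 p1 pr q1 qr qr2 pq qn rn nr pl ql; case; lia.
- move=> u v p q uk vk uv pn qn pq pqe; rewrite /half_odd.
  have /= [[w1 _ mC oC _] [[_ m1 m2 m3] _]] := matching_edge uk vk uv.
  have [y4 yu yv yz] := pickP uk vk uv.
  have vu : v != u by rewrite eq_sym.
  have [z4 zv zu _] := pickP vk uk vu.
  have uvC : (v < u) = ~~ (u < v) by lia.
  move: (pick u v) (pick v u) y4 yu yv yz z4 zv zu => y z y4 yu yv yz z4 zv zu.
  case: ifP => p0; first by do 5 (case: ifP => ?; try lia).
  case: (boolP (q == 0)) => q0 /=; first by do 4 (case: ifP => ?; try lia).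
  case: ifP => p1;
    first by do 3 (case: ifP => ?; first lia); case: ifP => _; exact: vertex_neq_side.
  case: ifP => pr;
    first by do 3 (case: ifP => ?; first lia); case: ifP => _; exact: vertex_neq_side.
  case: ifP => pr2;
    first by do 3 (case: ifP => ?; first lia); case: ifP => _; exact: vertex_neq_side.
  case: (boolP (q == 1)) => q1 /=; first by case: ifP => _; apply/nesym; exact: vertex_neq_side.
  case: (boolP (q == r.+1)) => qr /=; first by case: ifP => _; apply/nesym; exact: vertex_neq_side.
  case: (boolP (q == r.*2.+1)) => qr2 /=;
    first by case: ifP => _; apply/nesym; exact: vertex_neq_side.
  case: ifP => pl; case: ifP => ql; rewrite ?oC => /addnI /side_eq [] // E;
    try by exfalso; clear - E m1 m2 m3 mC; lia.
  rewrite uvC; move: (u < v); clear - r0 rn nr p1 pr q1 qr pl ql pqe; by case=> /=; lia.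
- move=> u v w p q uk vk wk uv uw vw p0 pq qn pqm; rewrite /half_odd.
  have /= [[x1 z1 _ _ _] [[U m1 m2 m3] m4]] := matching_edge uk wk uw.
  move: U; rewrite /= !inE !negb_or => /and4P[/and3P[? ux uz] ? ? _].
  have m5 := matching_star uk vk wk uv uw vw.
  have -> : (p == 0) = false by lia.
  have -> : (q == 0) = false by lia.
  have -> : (p == r.+1) = false by lia.
  have -> : (p == r.*2.+1) = false by lia.
  have -> /= : p <= r by lia.
  case: ifP => p1.
    case: ifP => q1; first by lia.
    case: ifP => q2; first by lia.
    case: ifP => q3; first by lia.
    by case: ifP => _; exact: vertex_neq_side.
  have -> /= : (q == 1) = false by lia.
  have -> /= : (q == r.*2.+1) = false by lia.
  case: ifP => q2; first by apply/nesym; exact: vertex_neq_side.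
  case: ifP => qr /addnI /side_eq [] // E; first by lia.
  case: (eqVneq v (other1 u w)) => [->|vx]; last first.
    by have := matching_star uk vk x1 uv ux vx; rewrite E eqxx.
  by move: (u < _); clear - p0 p1 q2 pq pqm qr; case; lia.
- move=> u v w p q uk vk wk uv uw vw p0 pn qn pqm; rewrite /half_odd.
  have wu : w != u by rewrite eq_sym.
  have [z4 zv zu _] := pickP wk uk wu.
  have -> : (p == 0) = false by lia.
  have -> : (q == 0) = false by lia.
  have -> : (q == 1) = false by lia.
  have -> : (q == r.+1) = false by lia.
  have -> : (p == r.+1) = false by lia.
  have -> : (p == r.*2.+1) = false by lia.
  have -> : (q <= r) = false by lia.
  have -> /= : p <= r by lia.
  case: ifP => p1; case: ifP => q1; first by lia.
  + exact: vertex_neq_side.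
  + by apply/nesym; exact: vertex_neq_side.
  move=> /addnI /side_eq [] // _.
  by move: (u < v) (w < _); clear - r0 rn p0 p1 q1 pn qn pqm; do 2 case; lia.
Qed.

(** * Induction on [n] from the small cases *)

Definition ncolors (k m : nat) := 1 + odd m + k.-1 * m./2.

Definition schematic (k m n : nat) := exists c, scheme k m m n (ncolors k m) c.

Lemma scheme_weaken k e e' m n N c : e' <= e ->
  scheme k e m n N c -> scheme k e' m n N c.
Proof. by move=> ee [? ? ? He ?]; split=> // u v p q *; apply: He => //; lia. Qed.

Lemma schematic_low k m n c j : 2 < k -> m < n ->
  scheme k n.-1 m n (ncolors k m) c -> schematic k (m + j.*2) (n + j.*2).
Proof.
move=> k2 mn S.
(* The iteration needs the full range along edges as invariant; it is weakened only at the end. *)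
suff [c' S'] : exists c', scheme k (n + j.*2).-1 (m + j.*2) (n + j.*2)
    (ncolors k (m + j.*2)) c'.
  by exists c'; apply: scheme_weaken S'; lia.
elim: j => [|j [c' IH]]; first by exists c; rewrite double0 !addn0.
have [||c2 S2] := scheme_extend_low _ _ IH; [by []|lia|].
exists c2; have -> : ncolors k (m + j.+1.*2) = ncolors k (m + j.*2) + k.-1.
  rewrite /ncolors (_ : (m + j.+1.*2)./2 = (m + j.*2)./2.+1); last by lia.
  by rewrite mulnS (_ : odd _ = odd (m + j.*2)); lia.
by rewrite doubleS !addnS; apply: scheme_weaken S2; lia.
Qed.

Lemma schematic_periodic k m n : m < n -> schematic k m n ->
  schematic k m (n + m.+1).
Proof. by move=> mn [c S]; apply: scheme_periodic S. Qed.

Lemma schematic_mid k m n : 4 < k -> (uphalf m).*2 < n -> n <= m.+1.*2 ->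
  schematic k m n -> schematic k m.+2 (n + 4).
Proof.
move=> k4 Hn nm [c S].
have [|c' S'] := @scheme_extend_mid k m n _ c
  (fun u v => fresh k.-1 [:: cls k u v; cls k v u] (v < u)) k4 Hn nm _ S.
  move=> u v uk vk uv.
  have F i : i < 2 -> fresh k.-1 [:: cls k u v; cls k v u] i < k.-1 /\
      fresh k.-1 [:: cls k u v; cls k v u] i \notin [:: cls k u v; cls k v u].
    by move=> i2; apply: freshP => /=; lia.
  have [lt1 +] := F (v < u) ltac:(lia); rewrite !inE negb_or => /andP[/eqP ? /eqP ?].
  split=> //; rewrite (@eq_fresh _ [:: cls k v u; cls k u v] [:: cls k u v; cls k v u]).
    by apply/eqP; apply: fresh_neq => /=; lia.
  by move=> j; rewrite !inE orbC.
exists c'; have -> // : ncolors k m.+2 = ncolors k m + k.-1.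
by rewrite /ncolors /= negbK mulnS; lia.
Qed.

Lemma schematic_flip m n : (uphalf m).*2 < n -> n <= m + uphalf m + 1 ->
  schematic 4 m n -> schematic 4 m.+4 (n + 6).
Proof.
move=> Hn nm [c S]; have [c' S'] := scheme_extend_flip Hn nm S.
by exists c'; have -> // : ncolors 4 m.+4 = ncolors 4 m + 6; rewrite /ncolors; lia.
Qed.

(** The seeds (0,1), (1,2), (2,4), (3,5), (3,6) for [(m, n)] are moved along constant [n - m]; (0,2)
    is periodic. The value [m = 1] is excluded because [ncolors k 1 = 2], while for odd [n] the
    subdivision has odd cycles. *)
Lemma schematic_short k m n : 3 < k -> m != 1 -> m < n ->
  n <= m + 2 \/ odd m /\ 4 < k /\ n <= m + 3 -> schematic k m n.
Proof.
move=> k3 m1 mn nm; have k2 : 2 < k by lia.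
have mE : m = odd m + m./2.*2 by lia.
have [h hE] : exists h, h = m./2 by exists m./2.
rewrite -hE in mE; case: (boolP (odd m)) mE nm => om /= mE nm.
  have [h' h'E] : exists h', h = h'.+1 by exists h.-1; lia.
  have [n1|[n2|n3]] : n = 2 + h.*2 \/ n = 5 + h'.*2 \/ n = 6 + h'.*2 by lia.
  - rewrite n1 mE; apply: (@schematic_low k 1 2 _ h k2 erefl).
    by have := scheme_path2 k; rewrite /ncolors /= muln0; apply.
  - have [c S] := scheme_path5 k3.
    rewrite n2 (_ : m = 3 + h'.*2); last by lia.
    apply: (@schematic_low k 3 5 c) => //.
    by rewrite /ncolors /= muln1 (_ : _ + _ = k.+1) //; lia.
  - have [c S] := scheme_path6 (ltac:(lia) : 4 < k).
    rewrite n3 (_ : m = 3 + h'.*2); last by lia.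
    apply: (@schematic_low k 3 6 c) => //.
    by rewrite /ncolors /= muln1 (_ : _ + _ = k.+1) //; lia.
have [n1|n2] : n = 1 + h.*2 \/ n = 2 + h.*2 by lia.
  rewrite n1 mE; apply: (@schematic_low k 0 1 _ h k2 erefl).
  by have := scheme_path1 k; rewrite /ncolors /= muln0; apply.
case: (posnP h) => [h0|hp].
  rewrite n2 mE h0; apply: (@schematic_periodic k 0 1) => //.
  by exists (fun _ _ _ => 0); rewrite /ncolors /= muln0; apply: scheme_path1.
have [c S] := scheme_path4 k3.
rewrite (_ : n = 4 + h.-1.*2) 1?(_ : m = 2 + h.-1.*2); [|lia|lia].
apply: (@schematic_low k 2 4 c) => //.
by rewrite /ncolors /= muln1 (_ : _ + _ = k) //; lia.
Qed.

Lemma schematic_ge5 k m n : 4 < k -> m != 1 -> m < n -> schematic k m n.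
Proof.
move=> k4; elim/ltn_ind: n m => n IH m m1 mn.
case: (leqP m.+1.*2 n) => [nm|nm].
  have -> : n = n - m.+1 + m.+1 by lia.
  by apply: schematic_periodic; [lia | apply: IH => //; lia].
case: (leqP n (m + 2 + odd m)) => [nm'|nm'].
  by apply: schematic_short; lia.
(* Here [m - 2] would be the excluded value 1; only [n = 7] remains. *)
case: (eqVneq m 3) => m3.
  have [c S] := scheme_path7 (ltac:(lia) : 3 < k).
  rewrite m3 (_ : n = 7); last by lia.
  by exists c; rewrite /ncolors /= muln1 (_ : _ + _ = k.+1) //; lia.
rewrite (_ : n = n - 4 + 4); last by lia.
rewrite (_ : m = (m - 2).+2); last by lia.
apply: schematic_mid => //; [lia | lia |].
by apply: IH; lia.
Qed.

Lemma schematic_4 m n : m != 1 -> m < n -> schematic 4 m n.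
Proof.
elim/ltn_ind: n m => n IH m m1 mn.
case: (leqP m.+1.*2 n) => [nm|nm].
  have -> : n = n - m.+1 + m.+1 by lia.
  by apply: schematic_periodic; [lia | apply: IH => //; lia].
case: (leqP n (m + 2)) => [nm'|nm'].
  by apply: schematic_short => //; left.
have [r rE] : exists r, r = m./2 by exists m./2.
case: (leqP n (m + uphalf m + 1)) => [nmid|nlong]; last first.
  have : 0 < r by lia.
  rewrite /schematic /ncolors -rE => r0.
  case: (boolP (odd m)) => om.
    have -> : m = r.*2.+1 by lia.
    by eexists; apply: scheme_long_odd; lia.
  have -> : m = r.*2 by lia.
  by eexists; apply: scheme_long_even; lia.
case: (eqVneq n (m + 3)) => [n3|n3]; last first.
  (* Here [m - 4] would be the excluded value 1; the bounds leave [n = 9]. *)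
  case: (eqVneq m 5) => [m5|m5].
    have [c S] := scheme_K4_5_9.
    by rewrite m5 (_ : n = 9); [exists c | lia].
  rewrite (_ : n = n - 6 + 6) 1?(_ : m = (m - 4).+4); [|lia|lia].
  by apply: schematic_flip; [lia | lia | apply: IH; lia].
(* For [n = m + 3], the condition [(uphalf (m - 4)).*2 < n - 6] holds only for even [m]. *)
case: (boolP (odd m)) => om; last first.
  rewrite (_ : n = n - 6 + 6) 1?(_ : m = (m - 4).+4); [|lia|lia].
  by apply: schematic_flip; [lia | lia | apply: IH; lia].
case: (eqVneq r 1) => r1.
  have [c S] := scheme_K4_3_6.
  by rewrite (_ : m = 3) 1?(_ : n = 6); [exists c | lia | lia].
have [c S] := scheme_K4_5_8.
rewrite (_ : n = 8 + (r - 2).*2) 1?(_ : m = 5 + (r - 2).*2); [|lia|lia].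
exact: (@schematic_low 4 5 8 c).
Qed.

Lemma schematic_all k m n : 3 < k -> 1 < m -> m < n -> schematic k m n.
Proof.
move=> k3 m1 mn; case: (eqVneq k 4) => [->|k4]; first by apply: schematic_4; lia.
by apply: schematic_ge5; lia.
Qed.

(** * General bounds on the graph parameters *)

Lemma clique_number_le_chromatic (G : sgraph) :
  clique_number G <= chromatic_number G.
Proof.
rewrite /chromatic_number; case: ex_minnP => k /existsP[f /forallP fP] _.
apply/bigmax_leqP => A /forallP Aclq.
rewrite -[k in _ <= k]card_ord -(@card_in_imset _ _ f A) ?max_card // => x y xA yA fxy.
apply/eqP; apply: contraTT (eqxx (f x)) => xy.
have := forallP (fP x) y; rewrite {3}fxy fxy.
suff -> : adj x y by rewrite eqxx.
have /implyP/(_ xA)/forallP/(_ y)/implyP/(_ yA)/implyP := Aclq x; exact.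
Qed.

Lemma leq_chromatic (G : sgraph) k : colorable G k -> chromatic_number G <= k.
Proof. by rewrite /chromatic_number; case: ex_minnP => j _; apply. Qed.

Lemma card_gt3_max_degree (G : sgraph) : 3 <= max_degree G -> 3 < #|G|.
Proof.
move=> dG; case: (posnP #|G|) => [G0|Gp].
  by move: dG; rewrite /max_degree big1 // => x; have := card0_eq G0 x; rewrite inE.
have [x dx] := eq_bigmax (@degree G) Gp.
move: dG; rewrite /max_degree dx /degree => dx3.
apply: leq_trans (_ : #|x |: [set y | adj x y]| <= _); last exact: max_card.
by rewrite cardsU1 inE adj_irrefl.
Qed.

(** * Points and short walks in the subdivision *)

Section EdgePath.
Variables (G : sgraph) (n : nat).
Hypothesis G_complete : complete G.
Hypothesis n_gt0 : 0 < n.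
Implicit Types (u v w : G) (p q : nat).
Notation S := (subdivision G n).
Notation rk := (fun u : G => enum_rank u : nat).

Lemma rk_neq u v : u != v -> rk u != rk v.
Proof. by apply: contraNN => /eqP/val_inj/enum_rank_inj ->. Qed.

Lemma is_edge_rk u v : rk u < rk v -> is_edge (u, v).
Proof.
move=> uv; rewrite /is_edge /= uv andbT; apply: G_complete.
by apply: contraTneq uv => ->; rewrite ltnn.
Qed.

(* [p] is measured from [u], whatever the orientation of the edge in [edge G];
   for [u = v] the value is junk. *)
Definition point u v p : S :=
  match @idP (rk u < rk v), @idP (rk v < rk u) with
  | ReflectT uv, _ => edge_point n (Sub (u, v) (is_edge_rk uv) : edge G) p
  | _, ReflectT vu => edge_point n (Sub (v, u) (is_edge_rk vu) : edge G) (n - p)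
  | _, _ => inl u
  end.

Lemma pointE (e : edge G) p : point (val e).1 (val e).2 p = edge_point n e p.
Proof.
case: e => -[u v] e; rewrite /point /=; have /andP[_ /= uv] := e.
case: {-}_ / idP => // uv'.
by congr edge_point; apply: val_inj.
Qed.

Lemma point_lt u v p (uv : rk u < rk v) :
  point u v p = edge_point n (Sub (u, v) (is_edge_rk uv) : edge G) p.
Proof. by rewrite -pointE. Qed.

Lemma point_gt u v p : rk v < rk u -> point u v p = point v u (n - p).
Proof.
move=> vu; rewrite (point_lt _ vu) /point.
case: {-}_ / idP => [uv|_]; first by lia.
case: {-}_ / idP => // vu'.
by congr edge_point; apply: val_inj.
Qed.

Lemma point_sym u v p : u != v -> p <= n -> point v u p = point u v (n - p).
Proof.
move=> /rk_neq uv pn; case: (ltngtP (rk u) (rk v)) uv => // [uv|vu] _.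
  exact: point_gt.
by rewrite [in RHS]point_gt // subKn.
Qed.

Lemma edge_point_n (e : edge G) : edge_point n e n = inl (val e).2.
Proof.
rewrite /edge_point; case: n n_gt0 => // n' _.
by case: insubP => // i; rewrite ltnn.
Qed.

Lemma edge_point_mid (e : edge G) p (pn : p < n.-1) :
  edge_point n e p.+1 = inr (e, Ordinal pn).
Proof.
rewrite /edge_point; case: insubP => [i _ iE|]; last by rewrite pn.
by congr (inr (_, _)); apply: val_inj.
Qed.

Lemma edge_point_inj (e f : edge G) p q : 0 < p < n -> q <= n ->
  edge_point n e p = edge_point n f q -> e = f /\ p = q.
Proof.
case: p => // p pn qn; have pn' : p < n.-1 by lia.
rewrite (edge_point_mid _ pn'); case: q qn => // q qn.
case: (ltnP q n.-1) => [qn'|qn'].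
  by rewrite (edge_point_mid _ qn') => -[-> ->].
have qE : q.+1 = n by lia.
by rewrite [X in edge_point n f X]qE edge_point_n.
Qed.

Lemma point0 u v : u != v -> point u v 0 = inl u.
Proof.
move=> /rk_neq uv; case: (ltngtP (rk u) (rk v)) uv => // [uv|vu] _.
  by rewrite (point_lt _ uv).
by rewrite point_gt // (point_lt _ vu) subn0 edge_point_n.
Qed.

Lemma pointn u v : u != v -> point u v n = inl v.
Proof. by move=> uv; rewrite point_sym 1?eq_sym // subnn point0 // eq_sym. Qed.

Lemma point_mid u v p : 0 < p < n -> u != v -> forall a, point u v p <> inl a.
Proof.
move=> pn /rk_neq uv a.
wlog {uv} uv : u v p pn / rk u < rk v.
  move=> W; case: (ltngtP (rk u) (rk v)) uv => // [uv|vu] _; first exact: W.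
  by rewrite point_gt //; apply: W => //; lia.
rewrite (point_lt _ uv); case: p pn => // p pn.
by rewrite (@edge_point_mid _ p ltac:(lia)).
Qed.

Lemma point_inl u v p a : p <= n -> u != v -> point u v p = inl a ->
  p = 0 /\ a = u \/ p = n /\ a = v.
Proof.
move=> pn uv; case: (posnP p) => [->|p0]; first by rewrite point0 // => -[<-]; left.
case: (eqVneq p n) => [->|pn']; first by rewrite pointn // => -[<-]; right.
by move/(point_mid _ uv); case; lia.
Qed.

Lemma point_inj u v p a b q : u != v -> a != b -> 0 < p < n -> q <= n ->
  point u v p = point a b q ->
  [/\ a = u, b = v & q = p] \/ [/\ a = v, b = u & q = n - p].
Proof.
move=> uv ab.
wlog uv' : u v p uv / rk u < rk v.
  move=> W pn qn; case: (ltngtP (rk u) (rk v)) (rk_neq uv) => // [uv'|vu] _; first exact: W.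
  rewrite (point_gt _ vu) => E.
  case: (W v u (n - p)) => //; [by rewrite eq_sym | lia | by right | ].
  by move=> [-> -> ->]; left; split=> //; lia.
wlog ab' : a b q ab / rk a < rk b.
  move=> W pn qn; case: (ltngtP (rk a) (rk b)) (rk_neq ab) => // [ab'|ba] _; first exact: W.
  rewrite (point_gt _ ba) => E.
  case: (W b a (n - q)) => //; [by rewrite eq_sym | lia | | ].
    by move=> [-> -> qE]; right; split=> //; lia.
  by move=> [-> -> qE]; left; split=> //; lia.
move=> pn qn; rewrite (point_lt _ uv') (point_lt _ ab').
by case/edge_point_inj => // -[-> ->] ->; left.
Qed.

Lemma adj_point u v p : u != v -> p < n -> @adj S (point u v p) (point u v p.+1).
Proof.
move=> uv pn; case: (ltngtP (rk u) (rk v)) (rk_neq uv) => // [uv'|vu] _.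
  rewrite !(point_lt _ uv'); apply/existsP.
  exists (Sub (u, v) (is_edge_rk uv')); apply/existsP; exists (Ordinal pn).
  by apply/orP; left; apply/andP; split; apply/eqP.
rewrite !(point_gt _ vu) !(point_lt _ vu); apply/existsP.
have pn' : n - p.+1 < n by lia.
exists (Sub (v, u) (is_edge_rk vu)); apply/existsP; exists (Ordinal pn').
apply/orP; right; apply/andP; split; apply/eqP => //.
by rewrite -subSn.
Qed.

Lemma adj_pointP (x y : S) : adj x y ->
  exists u v p, [/\ u != v, p < n, x = point u v p & y = point u v p.+1].
Proof.
case/existsP => e /existsP[[p pn]].
have ue : (val e).1 != (val e).2.
  by case/andP: (valP e) => + _; apply: contraTneq => ->; rewrite adj_irrefl.
have eu : (val e).2 != (val e).1 by rewrite eq_sym.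
case/orP => /andP[/eqP -> /eqP ->].
  by exists (val e).1, (val e).2, p; split; rewrite ?pointE.
exists (val e).2, (val e).1, (n - p.+1); split=> //; first by lia.
  rewrite (point_sym ue) ?pointE; last by lia.
  by rewrite subKn.
rewrite (point_sym ue) ?pointE; last by lia.
by rewrite -subSn // subSS subKn // ltnW.
Qed.

(** Distinct original vertices are at least [n] apart, so a walk of [k < n] steps meets at most one
    of them: its ends lie on one edge or on two edges at that vertex. *)
Definition near k (x y : S) :=
  [\/ x = y,
     exists u v p q, [/\ u != v, p <= n, q <= n, x = point u v p & y = point u v q]
       /\ p <= q + k /\ q <= p + k
   | exists u v w p q, [/\ u != v, u != w & v != w] /\
       [/\ p <= n, q <= n, x = point u v p, y = point u w q & p + q <= k]].

Lemma near_end k u v w p : u != v -> u != w -> p <= n -> p <= k ->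
  near k.+1 (point u v p) (point u w 1).
Proof.
move=> uv uw pn pk; case: (eqVneq v w) => [<-|vw].
  by apply: Or32; exists u, v, p, 1; split=> //; lia.
by apply: Or33; exists u, v, w, p, 1; split=> //; split=> //; lia.
Qed.

Lemma near_step k (x y z : S) : k < n -> near k x y -> adj y z -> near k.+1 x z.
Proof.
move=> kn xy /adj_pointP[a [b [j [ab jn yE zE]]]].
case: xy => [->|[u [v [p [q [[uv pn qn xE yE'] [pq qp]]]]]]
  |[u [v [w [p [q [[uv uw vw] [pn qn xE yE' pq]]]]]]]].
- move=> *; apply: Or32; exists a, b, j, j.+1; split; last by lia.
  by split=> //; lia.
- move: yE'; rewrite yE; case: (posnP j) => [j0|j0].
    rewrite zE j0 point0 // => /esym/point_inl; case=> // -[qE aE].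
      by rewrite xE aE; rewrite aE in ab; apply: near_end => //; lia.
    (* The walk leaves through the far end [v], so [x] is now measured from [v]. *)
    rewrite aE in ab *; rewrite xE -[p in point _ _ p](subKn pn) -point_sym //; last by lia.
    by apply: near_end; rewrite // 1?eq_sym //; lia.
  case/point_inj => //; [lia | | ] => -[uE vE qE].
    apply: Or32; exists u, v, p, j.+1; rewrite zE -uE -vE.
    by split; [split=> //; lia | lia].
  apply: Or32; exists u, v, p, (q.-1); rewrite zE -uE -vE; split; last by lia.
  split=> //; first by lia.
  rewrite point_sym //.
  by rewrite (_ : n - j.+1 = q.-1) //; lia.
(* As [q <= k < n], [y] can be an original vertex only at the common end [u]. *)
- move: yE'; rewrite yE; case: (posnP j) => [j0|j0].
    rewrite zE j0 point0 // => /esym/point_inl; case=> // -[qE aE]; last by lia.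
    by rewrite xE aE; rewrite aE in ab; apply: near_end => //; lia.
  case/point_inj => //; [lia | | ] => -[uE wE qE].
    apply: Or33; exists u, v, w, p, j.+1; rewrite zE -uE -wE.
    by split=> //; split=> //; lia.
  apply: Or33; exists u, v, w, p, (q.-1); rewrite zE -uE -wE; split=> //.
  split=> //; try lia.
  rewrite point_sym //.
  by rewrite (_ : n - j.+1 = q.-1) //; lia.
Qed.

Lemma walk_near k (x y : S) : k < n -> walk k x y -> near k x y.
Proof.
move=> kn /walkP[s [+ + sk]]; rewrite -sk in kn *.
elim/last_ind: s {sk} y kn => [|s z IH] y; first by move=> _ _ <-; apply: Or31.
rewrite size_rcons rcons_path last_rcons => kn /andP[xs sz] <-.
by apply: near_step sz; [lia | apply: IH => //; lia].
Qed.

Lemma walk_cat k l (x y z : S) : walk k x y -> walk l y z -> walk (k + l) x z.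
Proof.
case/walkP=> s [xs sy <-] /walkP[t [yt tz <-]]; apply/walkP; exists (s ++ t).
by rewrite cat_path last_cat sy xs yt tz size_cat.
Qed.

Lemma walk_point u v p : u != v -> p <= n -> walk p (inl u : S) (point u v p).
Proof.
move=> uv; elim: p => [|p IH] pn.
  by apply/walkP; exists [::]; rewrite point0.
rewrite -[X in walk X]addn1; apply: walk_cat (IH (ltnW pn)) _; apply/walkP.
exists [:: point u v p.+1]; split=> //.
by apply/andP; split; first exact: adj_point.
Qed.

Lemma dist_le_point m u v w p q : u != v -> u != w -> p <= n -> q <= n ->
  p + q <= m -> dist_le m (point u v p) (point u w q).
Proof.
move=> uv uw pn qn pqm; apply/dist_leP; exists (p + q) => //.
by apply: walk_cat (walk_point uw qn); rewrite walk_sym; apply: walk_point.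
Qed.
End EdgePath.

(** * Colouring and clique in the fractional power *)

Section FracPower.
Variables (G : sgraph) (m n : nat).
Hypothesis G_complete : complete G.
Hypothesis m_lt_n : m < n.

Let n_gt0 : 0 < n. Proof. by lia. Qed.
Notation point := (@point G n G_complete).

Lemma frac_power_colorable N c : 1 < #|G| -> scheme #|G| m m n N c ->
  colorable (frac_power G m n) N.
Proof.
move=> G1 [clt csym cc cedge cstar].
pose rk (u : G) := enum_rank u : nat.
have rklt u : rk u < #|G| by apply: ltn_ord.
have rkN u v : u != v -> rk u != rk v by apply: rk_neq.
(* Read as a number, [rk u == 0] names a vertex other than [u]; any other gives the same colour by
   the centre condition. *)
pose col (x : subdivision G n) := match x with
  | inl u => c (rk u) (rk u == 0) 0
  | inr (e, i) => c (rk (val e).1) (rk (val e).2) i.+1 end.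
have colE u v p : u != v -> p <= n -> col (point u v p) = c (rk u) (rk v) p.
  have inlE a b : a != b -> col (inl a) = c (rk a) (rk b) 0.
    by move=> ab /=; apply: cc; rewrite ?rkN ?rklt //; lia.
  move=> uv; wlog uv' : u v p uv / rk u < rk v.
    move=> W pn; case: (ltngtP (rk u) (rk v)) (rkN _ _ uv) => // [uv'|vu] _; first exact: W.
    rewrite (csym (rk v)) ?rkN ?rklt 1?eq_sym //.
    rewrite (point_gt _ _ _ vu) //; apply: W => //; first by rewrite eq_sym.
    exact: leq_subr.
  move=> pn; case: (posnP p) => [->|p0]; first by rewrite point0 // (inlE _ v).
  case: (eqVneq p n) => [->|pn'].
    rewrite pointn // (inlE _ u) 1?eq_sym // (csym (rk u)) ?rkN //.
    by rewrite subn0.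
  rewrite (@point_lt G n G_complete u v p uv'); case: p p0 pn pn' => // p _ pn pn'.
  by rewrite (edge_point_mid _ (_ : p < n.-1)) //; lia.
have collt x : col x < N.
  case: x => [u|[e i]] /=.
    by apply: clt; rewrite ?rklt //; lia.
  apply: clt => //; last by have := ltn_ord i; lia.
  by apply: rkN; case/andP: (valP e) => + _; apply: contraTneq => ->; rewrite adj_irrefl.
apply/existsP; exists [ffun x => Ordinal (collt x)].
apply/forallP => x; apply/forallP => y; apply/implyP => /andP[xy /dist_leP[k km]].
move=> /(walk_near G_complete n_gt0 (leq_ltn_trans km m_lt_n)) xyk; rewrite !ffunE -val_eqE /=.
apply/eqP; case: xyk xy => [->|[u [v [p [q [[uv pn qn -> ->] [pq qp]]]]]]
  |[u [v [w [p [q [[uv uw vw] [pn qn -> -> pq]]]]]]]]; first by rewrite eqxx.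
  move=> pqN; rewrite !colE //; case: (ltngtP p q) => pq'.
  - by apply: cedge; rewrite ?rkN //; lia.
  - by apply/nesym; apply: cedge; rewrite ?rkN //; lia.
  - by rewrite pq' eqxx in pqN.
(* The common end lies on both edges, so a pair containing it falls under the edge condition. *)
case: (posnP p) => [->|p0].
  case: (posnP q) => [->|q0 _]; first by rewrite !point0 // eqxx.
  by rewrite !colE // (cc _ _ (rk w)) ?rkN //; apply: cedge; rewrite ?rkN //; lia.
case: (posnP q) => [->|q0] _; last first.
  by rewrite !colE //; apply: cstar; rewrite ?rkN //; lia.
rewrite !colE // (cc _ (rk w) (rk v)) ?rkN //; apply/nesym.
by apply: cedge; rewrite ?rkN //; lia.
Qed.

(** Two points of the ball of radius [m./2] around [x] are joined through [x] within [m] steps; for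
    odd [m] one point at distance [r.+1] fits too, since [r + r.+1 = m]. *)
Lemma clique_number_frac_power : 1 < #|G| -> 1 < m ->
  1 + odd m + #|G|.-1 * m./2 <= clique_number (frac_power G m n).
Proof.
move=> G1 m1; have /card_gt0P[x _] := ltnW G1.
have [y yx] : exists y : G, x != y.
  have /card_gt0P[y] : 0 < #|[set~ x]| by rewrite cardsC1; lia.
  by rewrite !inE eq_sym; exists y.
have [r rE] : exists r, r = m./2 by exists m./2.
have mE : m = odd m + r.*2 by lia.
pose star : {set subdivision G n} :=
  [set point x a.1 (a.2 : 'I_r).+1 | a in setX [set~ x] [set: 'I_r]].
pose A := inl x |: star.
pose B := if odd m then point x y r.+1 |: A else A.
have starP z : z \in star ->
    exists v i, [/\ x != v, 0 < i <= r & z = point x v i].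
  case/imsetP => -[v i]; rewrite !inE andbT => /= vx ->.
  by exists v, i.+1; split; [rewrite eq_sym | rewrite /= ltn_ord | ].
have AP z : z \in A -> exists v i, [/\ x != v, i <= r & z = point x v i].
  rewrite in_setU1 => /orP[/eqP ->|/starP[v [i [xv /andP[_ ir] ->]]]]; last by exists v, i.
  by exists y, 0; rewrite point0.
have cstar : #|star| = #|G|.-1 * r.
  rewrite card_in_imset; first by rewrite cardsX cardsC1 cardsT card_ord.
  move=> [v i] [w j]; rewrite !inE !andbT => /= vx wx /point_inj.
  case; rewrite // 1?eq_sym //; try by have := ltn_ord i; have := ltn_ord j; lia.
    by move=> [_ -> [ij]]; congr pair; apply: val_inj.
  by move=> [_ xw _]; rewrite xw eqxx in wx.
have cA : #|A| = 1 + #|G|.-1 * r.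
  rewrite cardsU1 cstar; suff -> : inl x \notin star by [].
  apply/negP => /starP[v [i [xv ir]]] /esym/point_mid; apply; rewrite //; lia.
have cB : #|B| = 1 + odd m + #|G|.-1 * r.
  rewrite /B; case: ifP => om; last by rewrite cA.
  rewrite cardsU1 cA; suff -> : point x y r.+1 \notin A by [].
  apply/negP => /AP[v [i [xv ir]]] /point_inj; case; rewrite //; try lia;
    move=> [_ vx iE]; first [lia | by rewrite vx eqxx in xv].
rewrite -rE -cB; apply: (@leq_bigmax_cond _ _ (fun A : {set frac_power G m n} => #|A|)).
apply/forallP => a; apply/implyP => aB; apply/forallP => b; apply/implyP => bB.
apply/implyP => ab; apply/andP; split=> //.
have close z t : z \in A -> t \in A -> dist_le m (z : subdivision G n) t.
  move=> /AP[v [i [xv ir ->]]] /AP[w [j [xw jr ->]]].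
  by apply: dist_le_point; rewrite //; lia.
have far z : odd m -> z \in A -> dist_le m (point x y r.+1) z.
  move=> om /AP[v [i [xv ir ->]]]; rewrite om in mE.
  by apply: dist_le_point; rewrite //; lia.
move: aB bB; rewrite /B; case: ifP => om; last exact: close.
move=> /setU1P[aE|aA] /setU1P[bE|bA].
- by rewrite aE bE eqxx in ab.
- by rewrite aE; apply: far.
- have := far _ om aA; rewrite bE => /dist_leP[k km w]; apply/dist_leP.
  by exists k; rewrite // walk_sym.
- exact: close.
Qed.
End FracPower.

Theorem theorem6p2 (G : sgraph) (m n : nat)
    (G_complete : complete G) (G_degree : 3 <= max_degree G)
    (m_gt1 : 1 < m) (m_lt_n : m < n) :
  chromatic_number (frac_power G m n) = clique_number (frac_power G m n).
Proof.
have G4 := card_gt3_max_degree G_degree.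
have G1 : 1 < #|G| by apply: leq_trans G4.
apply/eqP; rewrite eqn_leq clique_number_le_chromatic andbT.
have [c S] := schematic_all G4 m_gt1 m_lt_n.
apply: leq_trans (leq_chromatic (frac_power_colorable G_complete m_lt_n G1 S)) _.
exact: clique_number_frac_power.
Qed.
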